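(* Let $1/2\le\alpha\le 1$, let $n\ge 1$, and let $S$ be a set of $n$ points in $\mathbb{R}^2$ such that no line contains more than $n^{\alpha}$ points of $S$. Then the number of unordered pairs $\{p,q\}\subset S$ such that $|p-q|\in\mathbb{Q}$ and $\{p,q\}$ has rational angle is at most $4n^{1+\alpha}$.
   Context: Identify $\mathbb{R}^2$ with $\mathbb{C}$. A pair of distinct points $p,q$ has rational angle if the segment between them, viewed as the complex number $q-p=re^{\pi i\gamma}$ with $r>0$, has $\gamma\in\mathbb{Q}$; equivalently, the line through $p$ and $q$ makes an angle with the $x$-axis that is a rational multiple of $\pi$. *)

(* Defs.v *)
From Stdlib Require Import Reals Lra Lia QArith Qreals List ClassicalEpsilon.
Import ListNotations.
Open Scope R_scope.

Definition point : Type := (R * R)%type.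

Definition pbool (P : Prop) : bool :=
  if excluded_middle_informative P then true else false.

Definition rational_angle (p q : point) : Prop :=
  exists (r : R) (g : Q), 0 < r /\
    fst q - fst p = r * cos (PI * Q2R g) /\
    snd q - snd p = r * sin (PI * Q2R g).

Definition rational_dist (p q : point) : Prop :=
  exists d : Q, sqrt ((fst q - fst p) ^ 2 + (snd q - snd p) ^ 2) = Q2R d.

(* Line {(x,y) | a x + b y = c}, with (a,b) <> (0,0). *)
Definition on_line (a b c : R) (p : point) : Prop := a * fst p + b * snd p = c.

Definition line_count (S : list point) (a b c : R) : nat :=
  length (filter (fun p => pbool (on_line a b c p)) S).

(* all index pairs (i, j) with i < j < n, i.e. unordered pairs of positions *)
Definition index_pairs (n : nat) : list (nat * nat) :=
  flat_map (fun i => map (fun j => (i, j)) (seq (S i) (n - S i))) (seq 0 n).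

Definition good_pair_count (S : list point) : nat :=
  length (filter
    (fun ij => pbool (rational_dist (nth (fst ij) S (0,0)) (nth (snd ij) S (0,0))
                    /\ rational_angle (nth (fst ij) S (0,0)) (nth (snd ij) S (0,0))))
    (index_pairs (length S))).

(* Main.v *)
(** The good pairs are those whose difference is a w with a nonzero rational and w a root of
    unity. By Mann's theorem, a rational linear relation between k roots of unity without
    vanishing proper subsum involves, up to a common factor, only roots of unity of squarefree
    order with all prime divisors at most k. If v and v0 are both joined to p and to q, the
    equality (p - v) + (v - q) = (p - v0) + (v0 - q) is a relation with k = 4. So, unless v = v0
    or v is the reflection p + q - v0, the directions of p - v and v - q agree with that of p -
    v0 up to sixth roots of unity; off the line pq, two directions determine v. Hence at most 2
    + 36 vertices v not collinear with p and q are joined to both.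

    Let x be the sum of the degrees, i.e. twice the number of good pairs. Counting paths of
    length two, those within a line being at most x n^alpha in number, and using Cauchy-Schwarz,
    x^2 <= n (x n^alpha + 38 n^2). As n <= n^(2 alpha), the number t = x / n^(1 + alpha)
    satisfies t^2 <= t + 38, so t <= 8. *)

Require Import Defs.
From Stdlib Require Import Reals List Lra Lia ZArith Qreals.
From mathcomp Require all_boot all_order all_algebra all_field.
From mathcomp Require ring boolp Rstruct complex.
Open Scope R_scope.

(** * Polar form of the difference of a good pair *)

Definition good_pair (p q : point) : Prop := rational_dist p q /\ rational_angle p q.

Lemma good_pair_sym p q : good_pair p q -> good_pair q p.
Proof.
  intros [[d Dd] [r [g [r_gt0 [Dx Dy]]]]]; split.
  - exists d; rewrite <- Dd; f_equal; ring.
  - exists r, (g + 1)%Q.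
    rewrite Q2R_plus, RMicromega.Q2R_1, Rmult_plus_distr_l, Rmult_1_r, neg_cos, neg_sin.
    repeat split; lra.
Qed.

Lemma good_pair_irrefl p : ~ good_pair p p.
Proof.
  intros [_ [r [g [r_gt0 [Dx Dy]]]]].
  assert (H := sin2_cos2 (PI * Q2R g)); unfold Rsqr in H.
  assert (sin (PI * Q2R g) = 0) by (apply (Rmult_eq_reg_l r); lra).
  assert (cos (PI * Q2R g) = 0) by (apply (Rmult_eq_reg_l r); lra).
  nra.
Qed.

Lemma Q2R_pos_ratio (d : Q) : 0 < Q2R d ->
  exists a b : nat, a <> 0%nat /\ b <> 0%nat /\ Q2R d = INR a / INR b.
Proof.
  destruct d as [a b]; unfold Q2R; simpl; intros d_gt0.
  assert (b_gt0 : 0 < / IZR (Zpos b)) by (apply Rinv_0_lt_compat, IZR_lt; lia).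
  assert (a_gt0 : (0 < a)%Z) by (apply lt_IZR; nra).
  exists (Z.to_nat a), (Pos.to_nat b); repeat split; try lia.
  rewrite !INR_IZR_INZ, Z2Nat.id, positive_nat_Z by lia; reflexivity.
Qed.

(** The radius [r] is the distance, hence rational, and the conditions on [k] say that exp(it) is a
    [k]-th root of unity. Natural numbers carry this data over to the rationals of MathComp. *)
Lemma good_pair_polar p q : good_pair p q ->
  exists (a b k : nat) (t : R), a <> 0%nat /\ b <> 0%nat /\ k <> 0%nat /\
    cos (INR k * t) = 1 /\ sin (INR k * t) = 0 /\
    fst q - fst p = INR a / INR b * cos t /\ snd q - snd p = INR a / INR b * sin t.
Proof.
  intros [[d Dd] [r [g [r_gt0 [Dx Dy]]]]].
  assert (Dr : r = Q2R d).
  { rewrite <- Dd, Dx, Dy, <- (sqrt_pow2 r) at 1 by lra; f_equal.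
    assert (H := sin2_cos2 (PI * Q2R g)); unfold Rsqr in H; nra. }
  rewrite Dr in *; destruct (Q2R_pos_ratio d r_gt0) as [a [b [a0 [b0 Dab]]]].
  (* For [k] twice the denominator of [g], the angle [k t] is 2 pi times the numerator. *)
  exists a, b, (2 * Pos.to_nat (Qden g))%nat, (PI * Q2R g); rewrite <- Dab.
  assert (Dk : INR (2 * Pos.to_nat (Qden g)) * (PI * Q2R g) = 2 * (IZR (Qnum g) * PI)).
  { unfold Q2R; rewrite mult_INR, INR_IZR_INZ, (INR_IZR_INZ (Pos.to_nat _)), positive_nat_Z.
    simpl; field; apply not_0_IZR; lia. }
  assert (H : sin (IZR (Qnum g) * PI) = 0) by (apply sin_eq_0_1; eexists; reflexivity).
  rewrite Dk, cos_2a_sin, sin_2a, H; repeat split; auto; try lia; ring.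
Qed.

(* The theorem must be read with the standard library's notations, which MathComp overrides. *)
Module RationalAngles.
Import all_boot all_order all_algebra all_field.
Import ring boolp Rstruct complex.
Set Implicit Arguments. Unset Strict Implicit. Unset Printing Implicit Defensive.
Import Order.TTheory GRing.Theory Num.Theory.
Local Open Scope ring_scope.

(** * Cyclotomic polynomials and Galois conjugates over a general [numFieldType] *)

Lemma expr_root_Cyclotomic (F : numFieldType) d (z : F) :
  (0 < d)%N -> root (map_poly intr 'Phi_d) z -> z ^+ d = 1.
Proof.
move=> d_gt0 /rootP root_d.
have /(congr1 (map_poly (intr : int -> F))) := prod_Cyclotomic d_gt0.
rewrite (big_rem d) -?dvdn_divisors //= rmorphM rmorphB rmorph1 /= map_polyXn.
move/(congr1 (horner^~ z)); rewrite !hornerE root_d mul0r.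
by move/esym/eqP; rewrite subr_eq0 => /eqP.
Qed.

(** As a root of ['X^n - 1], [z] is a root of ['Phi_d] for some divisor [d] of [n]; then
    [z ^+ d = 1], and primitivity forces [d = n]. *)
Lemma root_Cyclotomic_prim (F : numFieldType) n (z : F) :
  n.-primitive_root z -> root (map_poly intr 'Phi_n) z.
Proof.
move=> prim_z; have n_gt0 := prim_order_gt0 prim_z.
have /(congr1 (map_poly (intr : int -> F))) := prod_Cyclotomic n_gt0.
rewrite rmorph_prod rmorphB rmorph1 /= map_polyXn => /(congr1 (horner^~ z)).
rewrite !hornerE (prim_expr_order prim_z) subrr horner_prod => /eqP.
rewrite prodf_seq_eq0 => /hasP[d]; rewrite -dvdn_divisors //= => d_dvd root_d.
have d_gt0 : (0 < d)%N := dvdn_gt0 n_gt0 d_dvd.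
suff -> : n = d by [].
apply/eqP; rewrite eqn_dvd d_dvd andbT (prim_order_dvd prim_z).
by rewrite (expr_root_Cyclotomic d_gt0).
Qed.

(** Irreducibility of ['Phi_n], carried over from [algC]: sharing the root [z], ['Phi_n] and [P] are
    not coprime over the rationals, so they share a root in [algC]. That root is a primitive [n]-th
    root of unity, with minimal polynomial ['Phi_n]. *)
Lemma Cyclotomic_dvdp_rat (F : numFieldType) n (z : F) (P : {poly rat}) :
  (0 < n)%N -> root (map_poly intr 'Phi_n) z -> root (map_poly ratr P) z ->
  map_poly intr 'Phi_n %| P.
Proof.
move=> n_gt0 Phi_z0 Pz0.
have ratr_int (K : numFieldType) (Q : {poly int}) :
    map_poly ratr (map_poly intr Q : {poly rat}) = map_poly intr Q :> {poly K}.
  by rewrite -map_poly_comp; apply: eq_map_poly => b; rewrite /= rmorph_int.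
pose Phi : {poly rat} := map_poly intr 'Phi_n.
have not_coprime : ~~ coprimep Phi P.
  rewrite -(coprimep_map (ratr : rat -> F)); apply/negP.
  by rewrite ratr_int => /coprimep_root/(_ Phi_z0)/negP; apply; exact: Pz0.
have [y Phi_y0 Py0] : exists2 y : algC,
    root (map_poly ratr Phi) y & root (map_poly ratr P) y.
  pose G := gcdp (map_poly ratr Phi) (map_poly ratr P : {poly algC}).
  have : size G != 1%N by rewrite /G -/(coprimep _ _) coprimep_map.
  by case/closed_rootP => y; rewrite root_gcd => /andP[]; exists y.
rewrite ratr_int in Phi_y0.
have [w prim_w] := C_prim_root_exists n_gt0.
have prim_y : n.-primitive_root y.
  by rewrite -(root_cyclotomic prim_w) -Cintr_Cyclotomic.
have [p [Dp _] dv_p] := minCpolyP y.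
suff -> : map_poly intr 'Phi_n = p by rewrite -dv_p.
apply: (map_inj_poly (fmorph_inj (ratr : rat -> algC))); first exact: rmorph0.
by rewrite ratr_int -Dp (minCpoly_cyclotomic prim_y) (Cintr_Cyclotomic prim_y).
Qed.

(** This replaces the Galois automorphism sending [z] to [z ^+ k]: the power is again primitive,
    hence a root of ['Phi_n], which divides [P]. *)
Lemma root_rat_prim_exp (F : numFieldType) n (z : F) (P : {poly rat}) k :
  n.-primitive_root z -> coprime k n ->
  root (map_poly ratr P) z -> root (map_poly ratr P) (z ^+ k).
Proof.
move=> prim_z co_kn.
case/(Cyclotomic_dvdp_rat (prim_order_gt0 prim_z) (root_Cyclotomic_prim prim_z))/dvdpP.
move=> Q ->.
rewrite rmorphM rootM /= -map_poly_comp.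
rewrite [X in _ || root X _](_ : _ = map_poly intr 'Phi_n) ?root_Cyclotomic_prim ?orbT //.
  by rewrite prim_root_exp_coprime.
by apply: eq_map_poly => b; rewrite /= rmorph_int.
Qed.

(** A root of ['Phi_n] has an order [m] dividing [n]. Then ['Phi_n] divides ['X^m - 1], which
    therefore vanishes at a primitive [n]-th root in [algC]; so [n] divides [m]. *)
Lemma prim_root_exists (C : numClosedFieldType) n :
  (0 < n)%N -> exists z : C, n.-primitive_root z.
Proof.
move=> n_gt0.
have : size (map_poly intr 'Phi_n : {poly C}) != 1%N.
  by rewrite (size_map_inj_poly (@intr_inj C)) // size_Cyclotomic eqSS -lt0n totient_gt0.
case/closed_rootP => z Phi_z0; exists z.
have [m prim_z m_dvd] := prim_order_exists n_gt0 (expr_root_Cyclotomic n_gt0 Phi_z0).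
suff -> : n = m by [].
have m_gt0 := prim_order_gt0 prim_z.
have [w prim_w] := C_prim_root_exists n_gt0.
pose P : {poly rat} := 'X^m - 1.
have root_P (K : numFieldType) (x : K) : root (map_poly ratr P) x = (x ^+ m == 1).
  by rewrite rmorphB rmorph1 /= map_polyXn rootE !hornerE subr_eq0.
have /(Cyclotomic_dvdp_rat n_gt0 Phi_z0) : root (map_poly ratr P) z.
  by rewrite root_P (prim_expr_order prim_z).
rewrite -(dvdp_map (ratr : rat -> algC)) => /root_dvdp.
rewrite -map_poly_comp (eq_map_poly (g := intr)) => [|b]; last by rewrite /= rmorph_int.
move/(_ w (root_Cyclotomic_prim prim_w)); rewrite root_P -(prim_order_dvd prim_w).
by move=> n_dvd; apply/eqP; rewrite eqn_dvd n_dvd.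
Qed.

(** * Mann's theorem on rational relations between roots of unity *)

Lemma sum_expr_unity (F : fieldType) p (x : F) :
  x ^+ p = 1 -> \sum_(j < p) x ^+ j = if x == 1 then p%:R else 0.
Proof.
case: eqVneq => [-> _ | x1 xp].
  by under eq_bigr do rewrite expr1n; rewrite sumr_const card_ord.
by apply/(mulfI (x := x - 1)); rewrite ?subr_eq0 // -subrX1 xp subrr mulr0.
Qed.

Lemma coprime_1Dmuln j m p :
  prime p -> coprime (1 + j * m) (p * m) = ~~ (p %| 1 + j * m)%N.
Proof.
move=> p_pr; rewrite coprimeMr coprime_sym prime_coprime //.
suff -> : coprime (1 + j * m) m by rewrite andbT.
by rewrite /coprime gcdnC addnC gcdnMDl gcdn1.
Qed.

(* When 1 + j m is coprime to p m the sum is a Galois conjugate of the relation.  At most one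
   j < p fails this; then p does not divide m, some residue f mod p is not of the form e i as
   #|I| < p, and the Fourier coefficient of the sums at f vanishes, which kills the last one. *)
Lemma mann_conjugates (C : numFieldType) (I : finType) (a : I -> rat) (e : I -> nat)
    p m (z : C) :
  prime p -> (p * m).-primitive_root z -> (p %| m)%N \/ (#|I| < p)%N ->
  \sum_i ratr (a i) * z ^+ e i = 0 ->
  forall j, (j < p)%N -> \sum_i ratr (a i) * z ^+ (e i * (1 + j * m)) = 0.
Proof.
move=> p_pr prim_z p_or rel0.
have conj j : coprime (1 + j * m) (p * m) ->
    \sum_i ratr (a i) * z ^+ (e i * (1 + j * m)) = 0.
  move=> co_j; pose P : {poly rat} := \sum_i (a i)%:P * 'X^(e i).
  have evalP x : (map_poly ratr P).[x] = \sum_i ratr (a i) * x ^+ e i :> C.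
    rewrite rmorph_sum horner_sum; apply: eq_bigr => i _.
    by rewrite rmorphM /= map_polyC map_polyXn !hornerE.
  have /(root_rat_prim_exp prim_z co_j)/rootP : root (map_poly ratr P) z.
    by apply/rootP; rewrite evalP.
  rewrite evalP; apply: etrans; apply: eq_bigr => i _.
  by rewrite -exprM mulnC.
case: (boolP (p %| m)%N) => [p_dvd j _ | p_ndvd].
  apply: conj; rewrite coprime_1Dmuln // addnC dvdn_addr ?dvdn_mull //.
  by rewrite dvdn1 neq_ltn prime_gt1 ?orbT.
case: p_or => [|I_lt_p j j_lt_p]; first by rewrite (negPf p_ndvd).
have [/conj //|] := boolP (coprime (1 + j * m) (p * m)).
rewrite coprime_1Dmuln // negbK => p_dvd_j.
(* A second exceptional index [k] would make [p] divide [(k - j) m], hence [k - j]. *)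
have uniq_j (k : 'I_p) : k != j :> nat -> \sum_i ratr (a i) * z ^+ (e i * (1 + k * m)) = 0.
  move=> k_neq; apply: conj; rewrite coprime_1Dmuln //; apply: contra k_neq => p_dvd_k.
  have : k * m == j * m %[mod p].
    by rewrite -(eqn_modDl 1) (eqP p_dvd_k) (eqP p_dvd_j).
  have co_pm : coprime p m by rewrite prime_coprime.
  have eq_le x y : (x <= y < p)%N -> x * m == y * m %[mod p] -> x = y.
    case/andP=> xy yp; rewrite eq_sym eqn_mod_dvd ?leq_mul // -mulnBl Gauss_dvdl //.
    by case: (posnP (y - x)) => [|xy_gt0 /(dvdn_leq xy_gt0)]; lia.
  case/orP: (leq_total k j) => kj; first by move/(eq_le _ _)->; rewrite // kj.
  by rewrite eq_sym => /(eq_le _ _)->; rewrite // kj /=.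
have p_gt0 := prime_gt0 p_pr.
have m_gt0 : (0 < m)%N by rewrite lt0n; apply: contraNneq p_ndvd => ->; rewrite dvdn0.
have [f nef] : exists f : 'I_p, forall i, (e i %% p)%N != f.
  pose g i := Ordinal (ltn_pmod (e i) p_gt0).
  have : (#|codom g| < p)%N by apply: leq_ltn_trans (leq_image_card _ _) I_lt_p.
  rewrite -[X in (_ < X)%N]card_ord => codom_lt.
  have /subsetPn[f _ f_notin] : ~~ ('I_p \subset codom g).
    by apply/negP => /subset_leq_card; rewrite leqNgt codom_lt.
  exists f => i; apply: contra f_notin => /eqP ei_f.
  by apply/codomP; exists i; apply/val_inj.
pose eps := z ^+ m.
have prim_eps : p.-primitive_root eps.
  by have := dvdn_prim_root prim_z (dvdn_mulr m (dvdnn p)); rewrite mulKn.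
have f_lt : (f <= p)%N by rewrite ltnW.
(* Here [p - f] serves as -f modulo [p]. Term [i] acquires the geometric sum of [eps] to the power
   [e i - f], which is 0 by [nef]. *)
have : \sum_(k < p) eps ^+ (k * (p - f)) * \sum_i ratr (a i) * z ^+ (e i * (1 + k * m)) = 0.
  under eq_bigr do rewrite mulr_sumr.
  rewrite exchange_big big1 //= => i _.
  under eq_bigr => k _.
    rewrite (_ : _ * (_ * _) = ratr (a i) * z ^+ (e i) * (eps ^+ (e i + (p - f))) ^+ k); last first.
      have -> : z ^+ (e i * (1 + k * m)) = z ^+ e i * eps ^+ (e i * k).
        by rewrite mulnDr muln1 exprD -exprM; congr (_ * _ ^+ _); lia.
      by rewrite -(exprM eps) mulnDl exprD [(k * (p - f))%N]mulnC; ring.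
    over.
  rewrite -mulr_sumr sum_expr_unity; last first.
    by rewrite -exprM mulnC exprM (prim_expr_order prim_eps) expr1n.
  rewrite -(prim_order_dvd prim_eps) ifF ?mulr0 //; apply/negbTE.
  apply: contra (nef i) => /eqP dvd0; rewrite -[X in _ == X](modn_small (ltn_ord f)).
  by rewrite -(eqn_modDr (p - f)) subnKC // modnn dvd0.
rewrite (bigD1 (Ordinal j_lt_p)) //= [X in _ + X]big1 ?addr0 => [/eqP|k k_neq].
  rewrite mulf_eq0 expf_eq0 (prim_root_eq0 prim_eps) (gtn_eqF p_gt0) andbF /=.
  by move/eqP.
by rewrite uniq_j ?mulr0.
Qed.

(** Testing only the sets that contain [i0] excludes every nonempty proper vanishing subsum, since
    the complement of a vanishing subsum vanishes too. [N] is chosen as the least common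
    exponent. *)
Theorem mann (C : numClosedFieldType) (I : finType) (a : I -> rat) (w : I -> C) i0 :
  (forall i, exists2 n, (0 < n)%N & w i ^+ n = 1) -> w i0 = 1 ->
  \sum_i ratr (a i) * w i = 0 ->
  (forall A : {set I}, i0 \in A -> \sum_(i in A) ratr (a i) * w i = 0 -> A = setT) ->
  exists N, [/\ (0 < N)%N, forall i, w i ^+ N = 1
    & forall p, prime p -> (p %| N)%N -> (p <= #|I|)%N && ~~ (p ^ 2 %| N)%N].
Proof.
move=> w_unity wi0 rel0 nondeg.
have exN : exists N, (0 < N)%N && [forall i, w i ^+ N == 1].
  have [n n_gt0 wn] : exists2 n : I -> nat, forall i, (0 < n i)%N & forall i, w i ^+ n i = 1.
    have w_unity' i : exists n, (0 < n)%N && (w i ^+ n == 1).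
      by have [n ? /eqP ?] := w_unity i; exists n; apply/andP.
    by exists (fun i => xchoose (w_unity' i)) => i; have /andP[? /eqP] := xchooseP (w_unity' i).
  exists (\prod_i n i)%N; rewrite prodn_gt0 //=; apply/forallP => i.
  by rewrite (bigD1 i) //= exprM wn expr1n.
case: (ex_minnP exN) => N /andP[N_gt0 /forallP wN] N_min.
exists N; split=> // [i|p p_pr p_dvd]; first exact/eqP.
apply/negPn/negP => p_bad; have [m DN] := dvdnP p_dvd; rewrite mulnC in DN.
have p_or : (p %| m)%N \/ (#|I| < p)%N.
  move: p_bad; rewrite negb_and negbK -ltnNge DN expnS expn1 dvdn_pmul2l ?prime_gt0 //.
  by case/orP; [right | left].
have [z prim_z] := prim_root_exists C N_gt0.
(* Averaging the p conjugates keeps only the terms with p %| e i.  By nondegeneracy those are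
   all terms, so w i ^+ m = 1 for all i, against the minimality of N. *)
pose e i := val (sval (prim_rootP prim_z (eqP (wN i)))).
have De i : w i = z ^+ e i by rewrite /e; case: (prim_rootP _ _).
have p_gt0 := prime_gt0 p_pr.
have m_gt0 : (0 < m)%N by move: N_gt0; rewrite DN muln_gt0 => /andP[].
pose eps := z ^+ m.
have prim_eps : p.-primitive_root eps.
  by have := dvdn_prim_root prim_z p_dvd; rewrite [X in (X %/ _)%N]DN mulKn.
have relA : \sum_(i in [set i | (p %| e i)%N]) ratr (a i) * w i = 0.
  have : \sum_(j < p) \sum_i ratr (a i) * z ^+ (e i * (1 + j * m)) = 0.
    rewrite big1 // => j _; apply: (mann_conjugates p_pr _ p_or) => //; first by rewrite -DN.
    by rewrite -[RHS]rel0; apply: eq_bigr => i _; rewrite De.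
  rewrite exchange_big /= => sum0.
  apply/(mulfI (x := p%:R)); first by rewrite pnatr_eq0 -lt0n.
  rewrite mulr0 -[RHS]sum0 big_mkcond mulr_sumr; apply: eq_bigr => i _.
  under eq_bigr => j _.
    rewrite (_ : _ * _ = ratr (a i) * w i * (eps ^+ e i) ^+ j); last first.
      by rewrite De mulnDr muln1 exprD mulrA -!exprM; congr (_ * _ ^+ _); lia.
    over.
  rewrite -mulr_sumr sum_expr_unity; last first.
    by rewrite -exprM mulnC exprM (prim_expr_order prim_eps) expr1n.
  by rewrite -(prim_order_dvd prim_eps) inE; case: ifP => _; rewrite ?mulr0 // mulrC.
have A_setT : [set i | (p %| e i)%N] = setT.
  (* Since [w i0 = 1], [N] divides [e i0], so [i0] lies in the set. *)
  apply: nondeg relA; rewrite inE (@dvdn_trans N) //.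
  by rewrite (prim_order_dvd prim_z) -De wi0.
have : (0 < m)%N && [forall i, w i ^+ m == 1].
  rewrite m_gt0; apply/forallP => i; rewrite De -exprM -(prim_order_dvd prim_z) DN.
  rewrite dvdn_pmul2r //; have : i \in [set i | (p %| e i)%N] by rewrite A_setT.
  by rewrite inE.
by move/N_min; rewrite DN leqNgt ltn_Pmull ?prime_gt1.
Qed.

(** * Common neighbours of two points *)

Definition rat_unity (C : numClosedFieldType) (z : C) : Prop :=
  exists (a : rat) (w : C) (n : nat),
    [/\ a != 0, (0 < n)%N, w ^+ n = 1 & z = ratr a * w].

Lemma rat_unity_neq0 (C : numClosedFieldType) (z : C) : rat_unity z -> z != 0.
Proof.
case=> a [w] [n] [a0 n0 wn ->]; rewrite mulf_neq0 ?fmorph_eq0 //.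
by apply/eqP => w0; move/eqP: wn; rewrite w0 expr0n eqn0Ngt n0 eq_sym oner_eq0.
Qed.

Lemma dvdn6_squarefree N : (0 < N)%N ->
  (forall p, prime p -> (p %| N)%N -> (p <= 4)%N && ~~ (p ^ 2 %| N)%N) -> (N %| 6)%N.
Proof.
move=> N_gt0 N_pr; apply/dvdn_partP => // p; rewrite mem_primes => /and3P[p_pr _ p_dvd].
have /andP[p_le4 p2_ndvd] := N_pr p p_pr p_dvd.
have : (logn p N <= 1)%N by rewrite leqNgt -pfactor_dvdn.
rewrite p_part; case: (logn p N) => [|[]] // _; rewrite expn1.
by move: p p_pr p_le4 {p_dvd p2_ndvd} => [|[|[|[|[|]]]]].
Qed.

(** Dividing A + B - A' - B' = 0 by [w0] makes the first root 1, as [mann] requires. No proper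
    subsum containing A vanishes: for two terms by the last three hypotheses, for one because A is
    nonzero, for three because the missing term is nonzero. *)
Lemma four_rat_unity (C : numClosedFieldType) (a : rat) (w0 : C) n (B A' B' : C) :
  let A := ratr a * w0 in
  a != 0 -> (0 < n)%N -> w0 ^+ n = 1 -> rat_unity B -> rat_unity A' -> rat_unity B' ->
  A + B = A' + B' -> A + B != 0 -> A != A' -> A != B' ->
  forall X, X = A' \/ X = B' -> exists (s : rat) (x : C), x ^+ 6 = 1 /\ X = ratr s * (w0 * x).
Proof.
move=> A a0 n0 w0n uB uA' uB' relAB AB0 AA' AB'.
have uA : rat_unity A by exists a, w0, n.
have w0_neq0 : w0 != 0 by apply: contraNneq (rat_unity_neq0 uA) => w00; rewrite /A w00 mulr0.
have [A_0 B_0] := (rat_unity_neq0 uA, rat_unity_neq0 uB).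
have [A'_0 B'_0] := (rat_unity_neq0 uA', rat_unity_neq0 uB').
have [b [wb [nb [b0 nb0 wbn DB]]]] := uB.
have [a' [wa' [na' [a'0 na'0 wa'n DA']]]] := uA'.
have [b' [wb' [nb' [b'0 nb'0 wb'n DB']]]] := uB'.
pose c (i : 'I_4) := nth 0 [:: a; b; - a'; - b'] i.
pose w (i : 'I_4) := nth 0 [:: 1; wb / w0; wa' / w0; wb' / w0] i.
have unity_div x k : (0 < k)%N -> x ^+ k = 1 -> exists2 m, (0 < m)%N & (x / w0) ^+ m = 1.
  move=> k0 xk; exists (k * n)%N; first by rewrite muln_gt0 k0.
  by rewrite expr_div_n exprM xk expr1n mulnC exprM w0n expr1n divr1.
have w_unity i : exists2 m, (0 < m)%N & w i ^+ m = 1.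
  case: i => [[|[|[|[|//]]]] ?]; rewrite /w /=.
  - by exists 1%N; rewrite ?expr1n.
  - exact: unity_div nb0 wbn.
  - exact: unity_div na'0 wa'n.
  exact: unity_div nb'0 wb'n.
pose o1 : 'I_4 := lift ord0 ord0; pose o2 : 'I_4 := lift ord0 (lift ord0 ord0).
pose o3 : 'I_4 := lift ord0 (lift ord0 (lift ord0 ord0)).
(* Multiplying each term by a truth value covers all subsums in one identity. *)
have sumE (f : 'I_4 -> bool) : w0 * (\sum_(i < 4 | f i) ratr (c i) * w i) =
    A *+ f ord0 + B *+ f o1 - A' *+ f o2 - B' *+ f o3.
  rewrite big_mkcond mulr_sumr !big_ord_recl big_ord0 -/o1 -/o2 -/o3 /=.
  rewrite /c /w /= !raddfN /= {}DB {}DA' {}DB' /A.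
  by do 4!case: (f _); rewrite /=; field.
have rel0 : \sum_i ratr (c i) * w i = 0.
  by apply: (mulfI w0_neq0); rewrite sumE mulr0 !mulr1n relAB; ring.
have [S|N [N_gt0 wN N_pr]] := mann w_unity (erefl : w ord0 = 1) rel0.
  move=> S0 /(congr1 ( *%R w0)); rewrite mulr0 sumE S0 mulr1n => sum0.
  suff [S1 S2 S3] : [/\ o1 \in S, o2 \in S & o3 \in S].
    apply/setP => -[i lt_i]; rewrite inE.
    case: i lt_i => [|[|[|[|//]]]] lt_i;
      [apply: etrans S0 | apply: etrans S1 | apply: etrans S2 | apply: etrans S3];
      by congr (_ \in S); apply/val_inj.
  have BE : B = A' + B' - A by rewrite -relAB; ring.
  move: sum0; case: (o1 \in S); case: (o2 \in S); case: (o3 \in S) => //;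
    rewrite !(mulr1n, mulr0n) => /eqP sum0; exfalso; move: sum0; apply/negP.
  - by rewrite (_ : _ - _ = B') //; rewrite BE; ring.
  - by rewrite (_ : _ - _ = A') //; rewrite BE; ring.
  - by rewrite !subr0.
  - by rewrite (_ : _ - _ = - B) ?oppr_eq0 //; rewrite BE; ring.
  - by rewrite addr0 subr0 subr_eq0.
  - by rewrite addr0 subr0 subr_eq0.
  by rewrite addr0 !subr0.
have w6 i : w i ^+ 6 = 1.
  apply: expr_dvd (wN i) _; apply: dvdn6_squarefree => // p p_pr p_dvd.
  by have := N_pr p p_pr p_dvd; rewrite card_ord.
move=> X [] ->.
  by exists a', (w o2); split=> //; rewrite DA' /w /=; field.
by exists b', (w o3); split=> //; rewrite DB' /w /=; field.
Qed.

Lemma card_bigcup_le (I T : finType) (F : I -> {set T}) m :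
  (forall i, (#|F i| <= m)%N) -> (#|\bigcup_i F i| <= #|I| * m)%N.
Proof.
move=> Fm; apply: (@leq_trans (\sum_i #|F i|)); last first.
  by rewrite -sum_nat_const; apply: leq_sum => i _.
elim/big_rec2: _ => [|i k A _ Ak]; first by rewrite cards0.
by rewrite (leq_trans (leq_card_setU _ _)) // leq_add2l.
Qed.

Lemma card_common_neighbours (C : numClosedFieldType) (T : finType) (P : T -> C)
    (z1 z2 : C) (V : {set T}) :
  injective P ->
  (forall v, v \in V -> [/\ rat_unity (z1 - P v), rat_unity (P v - z2)
    & forall s : rat, z1 - P v <> ratr s * (P v - z2)]) ->
  (#|V| <= 38)%N.
Proof.
move=> P_inj V_P; case: (set_0Vmem V) => [-> | [v0 v0V]]; first by rewrite cards0.
have [[a [w0 [n [a0 n0 w0n Da]]]] uB ncol] := V_P v0 v0V.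
have [x prim_x] := prim_root_exists C (isT : (0 < 6)%N).
have sumE v : (z1 - P v) + (P v - z2) = z1 - z2 by ring.
(* The excluded ratio -1 is the case [z1 = z2]; this supplies A + B != 0. *)
have z12 : z1 - z2 != 0.
  rewrite -(sumE v0) addr_eq0; apply/eqP => z1_v0; apply: (ncol (-1)).
  by rewrite rmorphN rmorph1 mulN1r.
pose dir (k : 'I_6) z := exists s : rat, z = ratr s * (w0 * x ^+ k).
(* 38 = 1 + 1 + 6 * 6: the vertex v0, its reflection in the midpoint of z1 z2, and at most one
   vertex for each pair of directions in w0 times the sixth roots of unity. *)
pose W (kl : 'I_6 * 'I_6) := [set v in V | `[< dir kl.1 (z1 - P v) /\ dir kl.2 (P v - z2) >]].
have V_sub : V \subset [set v0] :|: [set v | P v == z1 + z2 - P v0] :|: \bigcup_kl W kl.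
  apply/subsetP => v vV; rewrite !inE.
  have [//|v_v0] := eqVneq v v0; have [//|v_refl] := eqVneq (P v) (z1 + z2 - P v0).
  have [uA' uB' _] := V_P v vV.
  have /= four := four_rat_unity a0 n0 w0n uB uA' uB'.
  have dirE z : z = z1 - P v \/ z = P v - z2 -> exists k, dir k z.
    move=> zE; have [||||s [y [y6 ->]]] := four _ _ _ _ z zE.
    - by rewrite -Da !sumE.
    - by rewrite -Da sumE.
    - by rewrite -Da (inj_eq (addrI _)) (inj_eq oppr_inj) (inj_eq P_inj) eq_sym.
    - rewrite -Da; apply: contraNneq v_refl => eqz.
      by apply/eqP; rewrite -[LHS](subrK z2) -eqz; ring.
    by have [k ->] := prim_rootP prim_x y6; exists k, s.
  have [k dk] := dirE _ (or_introl erefl); have [l dl] := dirE _ (or_intror erefl).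
  by apply/bigcupP; exists (k, l) => //; rewrite inE vV; apply/asboolP.
apply: leq_trans (subset_leq_card V_sub) _.
apply: leq_trans (leq_card_setU _ _) _; apply: (@leq_add _ _ 2 36).
  apply: leq_trans (leq_card_setU _ _) _; rewrite cards1; apply: (@leq_add _ _ 1 1) => //.
  by apply/card_le1_eqP => u v; rewrite !inE => /eqP uE /eqP vE; apply: P_inj; rewrite uE.
apply: (@leq_trans (#|{: 'I_6 * 'I_6}| * 1)); last by rewrite card_prod !card_ord.
apply: card_bigcup_le => -[k l]; apply/card_le1_eqP => u v; rewrite !inE /=.
case/andP=> uV /asboolP[[s1 As1] [t1 Bt1]] /andP[vV /asboolP[[s2 As2] [t2 Bt2]]].
have [s12|s12] := eqVneq s1 s2.
  by apply: P_inj; apply: oppr_inj; apply: (addrI z1); rewrite As1 As2 s12.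
have [_ /rat_unity_neq0 B_neq0 col] := V_P u uV.
have t1_0 : t1 != 0 by apply: contraNneq B_neq0 => t10; rewrite Bt1 t10 rmorph0 mul0r.
(* With d and d' the two directions, (s1 - s2) d = P v - P u = (t2 - t1) d'. As [s1] and [s2]
   differ, d is a rational multiple of d', and the witness is the resulting ratio of [z1 - P u] to
   [P u - z2]. *)
case: (col (s1 * (t2 - t1) / (t1 * (s1 - s2)))).
have s12' : ratr s1 - ratr s2 != 0 :> C by rewrite subr_eq0 (inj_eq (fmorph_inj _)).
have t1_0' : ratr t1 != 0 :> C by rewrite fmorph_eq0.
have : (ratr s1 - ratr s2) * (w0 * x ^+ k) = (ratr t2 - ratr t1) * (w0 * x ^+ l).
  by rewrite !mulrBl -As1 -As2 -Bt1 -Bt2; ring.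
rewrite As1 Bt1 !(fmorph_div, rmorphM, rmorphB) /= => rel.
apply: (mulfI s12'); rewrite mulrCA rel; field.
by rewrite s12' t1_0'.
Qed.

(** * Counting paths of length two *)

Lemma leq_sqr_sum (T : finType) (d : T -> nat) :
  ((\sum_v d v) ^ 2 <= #|T| * \sum_v d v ^ 2)%N.
Proof.
rewrite -(leq_pmul2l (isT : 0 < 2)%N) expnS expn1 big_distrlr /= big_distrr /=.
have -> : (2 * (#|T| * \sum_v d v ^ 2) = \sum_u \sum_v (d u ^ 2 + d v ^ 2))%N.
  under [RHS]eq_bigr do rewrite big_split /= sum_nat_const.
  by rewrite big_split /= -big_distrr /= sum_nat_const addnn mul2n.
apply: leq_sum => u _; rewrite big_distrr; apply: leq_sum => v _.
exact: nat_Cauchy.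
Qed.

(** The squared degrees count the paths p, v, q. Those with [col v p q] are counted by their first
    edge, with at most [L] choices of q; the others by their ends, with at most [K] choices of v. *)
Lemma leq_sqr_edges (T : finType) (e : rel T) (col : T -> T -> T -> bool) (L K : nat) :
  (forall v p, e v p -> #|[set q | e v q && col v p q]| <= L)%N ->
  (forall p q, #|[set v | [&& e v p, e v q & ~~ col v p q]]| <= K)%N ->
  forall x, x = (\sum_v \sum_p e v p)%N -> (x ^ 2 <= #|T| * (x * L + K * #|T| ^ 2))%N.
Proof.
move=> colL ncolK _ ->; apply: leq_trans (leq_sqr_sum _) _; rewrite leq_mul2l; apply/orP; right.
have -> : (\sum_v (\sum_p e v p) ^ 2 = \sum_v \sum_p \sum_q (e v p * (e v q && col v p q)
    + [&& e v p, e v q & ~~ col v p q]))%N.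
  apply: eq_bigr => v _; rewrite expnS expn1 big_distrlr /=.
  apply: eq_bigr => p _; apply: eq_bigr => q _.
  by case: (e v p); case: (e v q); case: (col v p q).
under eq_bigr do under eq_bigr do rewrite big_split /=.
under eq_bigr do rewrite big_split /=.
have card_sum (A : pred T) : (\sum_v A v = #|[set v | A v]|)%N.
  by rewrite -sum1dep_card [RHS]big_mkcond /=; apply: eq_bigr => v _; case: (A v).
rewrite big_split leq_add //=.
  rewrite big_distrl leq_sum //= => v _; rewrite big_distrl leq_sum //= => p _.
  rewrite -big_distrr /= card_sum leq_mul2l.
  by case evp: (e v p) => //=; exact: colL.
rewrite exchange_big /=; under eq_bigr do rewrite exchange_big /=.
apply: (@leq_trans (\sum_(p : T) \sum_(q : T) K)); last first.
  by rewrite !sum_nat_const mulnA mulnC expnS expn1.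
by apply: leq_sum => p _; apply: leq_sum => q _; rewrite card_sum.
Qed.

(** * Unordered pairs of positions as double sums *)

Lemma length_filter_count (A : Type) (f : A -> bool) (s : list A) :
  length (List.filter f s) = count f s.
Proof. by elim: s => //= x s <-; case: (f x). Qed.

Lemma count_index_pairs (n : nat) (f : rel nat) :
  length (List.filter (fun ij => f (fst ij) (snd ij)) (index_pairs n))
  = (\sum_(i < n) \sum_(j < n | i < j) f i j)%N.
Proof.
rewrite length_filter_count /index_pairs.
rewrite -(big_mkord xpredT (fun i => \sum_(j < n | i < j) f i j)%N).
rewrite /index_iota subn0 -[List.seq 0 n]/(iota 0 n).
elim: (iota 0 n) => [|i s IHs] /=; first by rewrite big_nil.
rewrite big_cons count_cat IHs; congr (_ + _)%N.
(* Row [i] of [index_pairs] is convertible to a map over [index_iota i.+1 n]. *)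
rewrite -[LHS]/(count (fun ij => f ij.1 ij.2) (map (pair i) (index_iota i.+1 n))).
transitivity (\sum_(i.+1 <= j < n) f i j)%N.
  rewrite -sum1_count big_map [LHS]big_mkcond.
  by apply: eq_bigr => j _ /=; case: (f i j).
by rewrite (big_nat_widenl i.+1 0) // big_mkord.
Qed.

Lemma double_index_pairs (n : nat) (f : rel nat) :
  (forall i j, f i j = f j i) -> (forall i, f i i = false) ->
  (2 * length (List.filter (fun ij => f (fst ij) (snd ij)) (index_pairs n))
  = \sum_(i < n) \sum_(j < n) f i j)%N.
Proof.
move=> f_sym f_irr; rewrite count_index_pairs mul2n -addnn.
have -> : (\sum_(i < n) \sum_(j < n) f i j =
    \sum_(i < n) (\sum_(j < n | i < j) f i j + \sum_(j < n | j < i) f i j))%N.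
  apply: eq_bigr => i _; rewrite (bigID (fun j : 'I_n => i < j)%N) /=; congr (_ + _)%N.
  rewrite (bigID (fun j : 'I_n => j < i)%N) /= [X in (_ + X)%N]big1 ?addn0 => [|j].
    by apply: eq_bigl => j; case: ltngtP.
  by case: ltngtP => // /val_inj <-; rewrite f_irr.
rewrite big_split /=; congr (_ + _)%N.
under [RHS]eq_bigr do rewrite big_mkcond.
rewrite [RHS]exchange_big /=; apply: eq_bigr => i _.
by rewrite big_mkcond; apply: eq_bigr => j _; rewrite f_sym.
Qed.

(** * From the plane to the complex numbers *)

Lemma pboolP (P : Prop) : reflect P (pbool P).
Proof. by rewrite /pbool; case: ClassicalEpsilon.excluded_middle_informative => h; constructor. Qed.

Definition to_complex (p : point) : R[i] := Complex p.1 p.2.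

Lemma complex_exp_nat (t : R) k :
  (Complex (cos t) (sin t) : R[i]) ^+ k
  = Complex (cos (Rmult (INR k) t)) (sin (Rmult (INR k) t)).
Proof.
elim: k => [|k IHk]; first by rewrite Rmult_0_l cos_0 sin_0.
rewrite exprSr IHk S_INR Rmult_plus_distr_r Rmult_1_l cosD sinD.
by apply/eqP; rewrite eq_complex /= eqxx addrC eqxx.
Qed.

Lemma rat_unity_good p q : good_pair p q -> rat_unity (to_complex q - to_complex p).
Proof.
case/good_pair_polar => [a [b [k [t [/eqP a0 [/eqP b0 [/eqP k0 [cos1 [sin0 [Dx Dy]]]]]]]]]].
exists (a%:R / b%:R), (Complex (cos t) (sin t)), k; split.
- by rewrite mulf_neq0 ?invr_eq0 ?pnatr_eq0.
- by rewrite lt0n.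
- by rewrite complex_exp_nat cos1 sin0.
have Dr : ratr (a%:R / b%:R) = Rdiv (INR a) (INR b) :> R by rewrite fmorph_div !rmorph_nat !INRE.
rewrite -(fmorph_rat (real_complex R)) Dr.
apply/eqP; rewrite eq_complex /= !mul0r subr0 addr0.
by apply/andP; split; apply/eqP; rewrite -?Dx -?Dy.
Qed.

(** The cross product also vanishes for [p = q], so paths that return along the same edge are
    counted with the lines. *)
Definition collinear (v p q : point) : Prop :=
  (p.1 - v.1) * (q.2 - v.2) - (p.2 - v.2) * (q.1 - v.1) = 0 :> R.

Lemma not_collinear_ratr v p q (s : rat) : ~ collinear v p q ->
  to_complex p - to_complex v <> ratr s * (to_complex v - to_complex q).
Proof.
move=> ncol; rewrite -(fmorph_rat (real_complex R)) => /eqP; rewrite eq_complex /=.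
rewrite !mul0r subr0 addr0 => /andP[/eqP Dx /eqP Dy]; apply: ncol.
by rewrite /collinear Dx Dy; ring.
Qed.

Lemma line_count_sum (S : list point) a b c :
  line_count S a b c = (\sum_(i < length S) pbool (on_line a b c (List.nth i S (0, 0)%R)))%N.
Proof.
rewrite /line_count length_filter_count -sum1_count big_mkcond.
rewrite (big_nth ((0, 0)%R : point)) big_mkord; apply: eq_bigr => i _.
have nthE (s : list point) k : nth ((0, 0)%R : point) s k = List.nth k s (0, 0)%R.
  by elim: s k => [|y s IHs] [|k] //=.
by rewrite nthE; case: (pbool _).
Qed.

Lemma good_pair_count_sqr (S : list point) (L : nat) (n := length S) :
  List.NoDup S ->
  (forall a b c : R, a <> 0 \/ b <> 0 -> (line_count S a b c <= L)%N) ->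
  ((2 * good_pair_count S) ^ 2 <= n * ((2 * good_pair_count S) * L + 38 * n ^ 2))%N.
Proof.
move=> S_uniq S_lines; pose pt i := List.nth i S ((0, 0)%R : point).
pose e i j := pbool (good_pair (pt i) (pt j)).
pose col v p q := pbool (collinear (pt v) (pt p) (pt q)).
have e_sym i j : e i j = e j i by apply/pboolP/pboolP => /good_pair_sym.
have e_irr i : e i i = false by apply/pboolP/good_pair_irrefl.
have DX : (2 * good_pair_count S = \sum_(i < n) \sum_(j < n) e i j)%N.
  exact: double_index_pairs.
have := @leq_sqr_edges 'I_n e (fun v p q => col v p q) L 38 _ _ _ DX.
rewrite card_ord; apply=> [v p evp | p q].
  (* [(a, b)] is normal to the line through [v] and [p]; it is nonzero because a good pair consists
     of distinct points. *)
  pose a := (pt p).2 - (pt v).2; pose b := (pt v).1 - (pt p).1.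
  apply: leq_trans (S_lines a b (a * (pt v).1 + b * (pt v).2) _); last first.
    case: (eqVneq a 0) => [a0|/eqP]; [right=> b0 | by left].
    move/pboolP: evp; suff -> : pt v = pt p by move/good_pair_irrefl.
    by rewrite (surjective_pairing (pt v)) (subr0_eq b0) -(subr0_eq a0) -surjective_pairing.
  rewrite line_count_sum -sum1dep_card big_mkcond leq_sum // => i _.
  case: ifP => // /andP[_ /pboolP col_i]; rewrite lt0b; apply/pboolP.
  rewrite /on_line !RplusE !RmultE; apply/eqP; rewrite -subr_eq0; apply/eqP.
  by apply: etrans (etrans (congr1 -%R col_i) (oppr0 _)); rewrite /a /b -/(pt i); ring.
apply: (@card_common_neighbours _ _ (fun i : 'I_n => to_complex (pt i))
          (to_complex (pt p)) (to_complex (pt q))).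
  move=> i j [eq1 eq2]; apply/val_inj.
  apply: (proj1 (List.NoDup_nth S (0, 0)%R) S_uniq);
    [exact/ssrnat.ltP/ltn_ord | exact/ssrnat.ltP/ltn_ord|].
  change (pt i = pt j).
  by rewrite (surjective_pairing (pt i)) eq1 eq2 -surjective_pairing.
move=> v; rewrite inE => /and3P[/pboolP evp /pboolP evq /pboolP ncol]; split.
- exact: rat_unity_good.
- by apply: rat_unity_good; apply: good_pair_sym.
by move=> s; apply: not_collinear_ratr.
Qed.

Lemma good_pair_count_sqr_le (S : list point) (L : nat)
    (n := length S) (x := (2 * good_pair_count S)%N) :
  List.NoDup S ->
  (forall a b c : R, a <> R0 \/ b <> R0 -> le (line_count S a b c) L) ->
  le (Nat.mul x x) (Nat.mul n (Nat.add (Nat.mul x L) (Nat.mul 38 (Nat.mul n n)))).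
Proof.
move=> S_uniq S_lines; apply/ssrnat.leP.
have := good_pair_count_sqr S_uniq (fun a b c ab => introT ssrnat.leP (S_lines a b c ab)).
by rewrite !expnS !expn0 !muln1.
Qed.

End RationalAngles.

(** * The final estimate over the reals *)

Lemma quadratic_bound (N X y : R) :
  1 <= N -> 0 <= X -> 0 <= y -> N <= y * y ->
  X * X <= N * (X * y + 38 * (N * N)) -> X <= 8 * (N * y).
Proof.
  (* Put M = N y, so that N^3 <= M^2. If X > 8 M, then 38 M^2 <= (38/8) M X, and X^2 <= (1 + 38/8) M
     X < 8 M X, a contradiction. *)
  intros N1 X0 y0 Ny HX; destruct (Rle_or_lt X (8 * (N * y))) as [H | H]; auto; exfalso.
  assert (M0 : 0 <= N * y) by nra.
  assert (N * (N * N) <= (N * y) * (N * y)) by (assert (0 <= N * N) by nra; nra).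
  nra.
Qed.

Theorem theorem4 (alpha : R) (n : nat) (S : list point) :
  1 / 2 <= alpha <= 1 ->
  (1 <= n)%nat ->
  NoDup S -> length S = n ->
  (forall a b c : R, (a <> 0 \/ b <> 0) ->
     INR (line_count S a b c) <= Rpower (INR n) alpha) ->
  INR (good_pair_count S) <= 4 * Rpower (INR n) (1 + alpha).
Proof.
  intros [alpha_ge _] n_ge1 S_uniq Sn S_lines; subst n.
  set (N := INR (length S)) in *; set (y := Rpower N alpha) in *.
  assert (N1 : 1 <= N) by (apply (le_INR 1); auto).
  assert (y0 : 0 < y) by apply exp_pos.
  (* Here [alpha >= 1/2] enters: [y * y] is [N] to the power [2 alpha]. *)
  assert (Ny : N <= y * y).
  { unfold y; rewrite <- Rpower_plus; rewrite <- (Rpower_1 N) at 1 by lra.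
    apply Rle_Rpower; lra. }
  destruct (base_Int_part y) as [floor_le floor_gt].
  assert (floor_ge0 : (0 <= Int_part y)%Z).
  { apply Z.lt_succ_r, lt_IZR; rewrite succ_IZR; lra. }
  (* The count needs a natural bound on the points of a line: being integers, the line counts are at
     most the floor of [y]. *)
  pose (L := Z.to_nat (Int_part y)).
  assert (DL : INR L = IZR (Int_part y)).
  { unfold L; rewrite INR_IZR_INZ, Z2Nat.id; auto. }
  assert (count := @RationalAngles.good_pair_count_sqr_le S L S_uniq).
  apply le_INR in count.
  2: { intros a b c ab; apply Nat.lt_succ_r, INR_lt; rewrite S_INR, DL.
       specialize (S_lines a b c ab); lra. }
  repeat rewrite ?mult_INR, ?plus_INR in count; fold N in count.
  set (G := INR (good_pair_count S)) in *.
  assert (G0 : 0 <= G) by apply pos_INR.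
  replace (INR 2) with 2 in count by (simpl; lra).
  replace (INR 38) with 38 in count by (simpl; lra).
  assert (2 * G <= 8 * (N * y)).
  { apply quadratic_bound; try lra.
    assert (2 * G * INR L <= 2 * G * y) by (rewrite DL; apply Rmult_le_compat_l; lra).
    assert (N * (2 * G * INR L) <= N * (2 * G * y)) by (apply Rmult_le_compat_l; lra).
    lra. }
  rewrite Rpower_plus, Rpower_1 by lra; fold y; lra.
Qed.
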